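(* Let $(E,\tau)$ be a linear topological space over $K$. Then $\sigma(E,\delta\text{-}E^{*})$ is the weakest topology on $E$ such that each member of $\delta\text{-}E^{*}$ is $\delta$-continuous; that is, every $f\in\delta\text{-}E^{*}$ is $\delta$-continuous as a map $(E,\sigma(E,\delta\text{-}E^{*}))\to K$, and if $\gamma$ is any topology on $E$ such that every $f\in\delta\text{-}E^{*}$ is $\delta$-continuous as a map $(E,\gamma)\to K$, then $\sigma(E,\delta\text{-}E^{*})\subseteq\gamma$.
   Context: $K$ is $\mathbb{R}$ or $\mathbb{C}$ with its usual topology. A linear topological space over $K$ is a $K$-vector space $E$ with a topology $\tau$ making addition and scalar multiplication continuous (no Hausdorff assumption is stated). In a topological space $X$, a set $U$ is regular open if $U=\operatorname{int}(\operatorname{cl}(U))$; a set $U\subseteq X$ is $\delta$-open if for each $x\in U$ there is a regular open set $P$ with $x\in P\subseteq U$. A map $f:X\to Y$ between topological spaces is $\delta$-continuous if the preimage of every open subset of $Y$ is a $\delta$-open subset of $X$. The $\delta$-topological dual $\delta\text{-}E^{*}$ of $(E,\tau)$ is the set of all linear functionals $E\to K$ that are $\delta$-continuous on $(E,\tau)$. The delta weak topology $\sigma(E,\delta\text{-}E^{*})$ is the locally convex topology on $E$ generated by the seminorms $p_f(x)=|f(x)|$, $f\in\delta\text{-}E^{*}$; a local base at the null vector consists of the sets $\bigcap_{i=1}^{n}\{x\in E:|f_i(x)|<r_i\}$ with $n\in\mathbb{N}$, $f_i\in\delta\text{-}E^{*}$, $r_i>0$. *)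

(* Defs.v *)
From HB Require Import structures.
From mathcomp Require Import all_boot all_order all_algebra.
From mathcomp Require Import complex.
From mathcomp Require Import all_classical all_reals topology.
From mathcomp Require Import tvs.

Set Implicit Arguments.
Unset Strict Implicit.
Unset Printing Implicit Defensive.

Import Order.TTheory GRing.Theory Num.Theory.
Import numFieldTopology.Exports.

Local Open Scope classical_set_scope.
Local Open Scope ring_scope.

Inductive scalar_kind := RealScalars | ComplexScalars.

(* Both branches carry the norm topology that numFieldTopology gives to any
   numFieldType: the usual topology of the real line and of the plane. *)
Definition scalars (R : realType) (k : scalar_kind) : numFieldType :=
  match k with
  | RealScalars => R
  | ComplexScalars => R[i]
  end.

Definition delta_open (X : topologicalType) (U : set X) : Prop :=
  forall x, U x -> exists P : set X, [/\ regopen P, P x & P `<=` U].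

Definition delta_continuous (X Y : topologicalType) (f : X -> Y) : Prop :=
  forall V : set Y, open V -> delta_open (f @^-1` V).

Definition delta_dual (K : numFieldType) (E : topologicalLmodType K) :
    set {scalar E} :=
  [set f : {scalar E} | delta_continuous (f : E -> K)].
Arguments delta_dual {K} E.

(* A copy of E carrying the locally convex topology generated by the seminorms
   x |-> `|f x|, f in F; only the vector space structure of E is used. *)
Definition seminorm_topology (K : numFieldType) (E : lmodType K)
  (F : set {scalar E}) : Type := E.

Section SeminormTopology.
Context (K : numFieldType) (E : lmodType K) (F : set {scalar E}).

Local Notation S := (seminorm_topology F).

(* The radii live in K; when K is complex, 0 < r forces r to be real. *)
Definition seminorm_base0 : set_system E :=
  [set B | exists n (f : 'I_n -> {scalar E}) (r : 'I_n -> K),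
     [/\ forall i, F (f i), forall i, 0 < r i &
         B = \bigcap_(i in [set: 'I_n]) [set x | `|f i x| < r i]]].

Definition seminorm_nbhs (x : S) : set_system S :=
  [set U | exists2 B, seminorm_base0 B & [set x + b | b in B] `<=` U].

HB.instance Definition _ := GRing.Lmodule.on S.
HB.instance Definition _ := hasNbhs.Build S seminorm_nbhs.

Lemma seminorm_base0I (A B : set E) :
  seminorm_base0 A -> seminorm_base0 B -> seminorm_base0 (A `&` B).
Proof.
move=> [n [f [r [Ff r0 ->]]]] [m [g [s [Fg s0 ->]]]].
exists (n + m)%N, (fun i : 'I_(n + m) => match fintype.split i with inl j => f j | inr j => g j end),
  (fun i : 'I_(n + m) => match fintype.split i with inl j => r j | inr j => s j end).
split; [by move=> i; case: (fintype.split i)..|].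
rewrite eqEsubset; split => [x [xA xB] i _|x xAB].
  by rewrite /=; case: (fintype.split i) => j; [exact: xA|exact: xB].
split=> i _ /=.
  by have := xAB (unsplit (inl i)) I; rewrite /mkset unsplitK.
by have := xAB (unsplit (inr i)) I; rewrite /mkset unsplitK.
Qed.

Lemma seminorm_base0_0 (B : set E) : seminorm_base0 B -> B 0.
Proof. by move=> [n [f [r [_ r0 ->]]]] i _ /=; rewrite raddf0 normr0. Qed.

Let seminorm_nbhs_filter (x : S) : ProperFilter (nbhs x).
Proof.
split.
  move=> [B /seminorm_base0_0 B0 BU].
  by apply: (BU (x + 0)); exists 0.
split.
- exists setT; last by [].
  exists 0%N, (fun=> \0), (fun=> 1); split=> [[]|[]|] //.
  by rewrite eqEsubset; split => // y _ [].
- move=> U V [A bA AU] [B bB BV].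
  exists (A `&` B); first exact: seminorm_base0I.
  by move=> _ [b [Ab Bb] <-]; split; [apply: AU|apply: BV]; exists b.
- by move=> U V UV [A bA AU]; exists A => // y /AU /UV.
Qed.

Let seminorm_nbhs_singleton (x : S) (U : set S) : nbhs x U -> U x.
Proof.
by move=> [B /seminorm_base0_0 B0]; apply; exists 0 => //; rewrite addr0.
Qed.

Let seminorm_nbhs_nbhs (x : S) (U : set S) : nbhs x U -> nbhs x (nbhs^~ U).
Proof.
move=> [B bB BU]; exists B => // _ [b Bb <-].
case: bB BU Bb => n [f [r [Ff r0 ->]]] BU Bb.
exists (\bigcap_(i in [set: 'I_n]) [set y | `|f i y| < r i - `|f i b|]).
  exists n, f, (fun i => r i - `|f i b|); split=> // i.
  by rewrite subr_gt0; exact: Bb.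
move=> _ [c cB <-]; apply: BU; exists (b + c); last by rewrite addrA.
move=> i _ /=; rewrite raddfD (le_lt_trans (ler_normD _ _))//.
by have := cB i I; rewrite /= ltrBrDl.
Qed.

HB.instance Definition _ := Nbhs_isNbhsTopological.Build S
  seminorm_nbhs_filter seminorm_nbhs_singleton seminorm_nbhs_nbhs.

End SeminormTopology.

Definition delta_weak (K : numFieldType) (E : topologicalLmodType K) :
  topologicalType := seminorm_topology (delta_dual E).

(* Main.v *)
(** In a regular target space (such as the scalar field) continuity and
    delta-continuity coincide: if a closed neighbourhood [C] of [f x] lies in
    the open set [V], then the interior of the closed set [f @^-1` C] is a
    regular open neighbourhood of [x] inside [f @^-1` V].  The statement is
    therefore the universal property of the initial topology of the dual. *)
Require Import Defs.
From mathcomp Require Import all_boot all_order all_algebra.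
From mathcomp Require Import all_classical all_reals topology.
From mathcomp Require Import tvs.
Import GRing.Theory Num.Theory.
Import numFieldTopology.Exports.
Local Open Scope classical_set_scope.
Local Open Scope ring_scope.

Lemma delta_open_open (X : topologicalType) (U : set X) :
  delta_open U -> open U.
Proof.
move=> dU; rewrite openE => x /dU[P [rP Px PU]].
have oP : open P by rewrite -rP; exact: open_interior.
exact: filterS PU (open_nbhs_nbhs (conj oP Px)).
Qed.

Lemma delta_continuous_continuous (X Y : topologicalType) (f : X -> Y) :
  delta_continuous f -> continuous f.
Proof. by move=> df; apply/continuousP => V /df/delta_open_open. Qed.

Lemma continuous_delta_continuous (X Y : topologicalType) (f : X -> Y) :
  regular_space Y -> continuous f -> delta_continuous f.
Proof.
move=> rY cf V oV x Vfx.
have [W Wfx WV] := rY _ _ (open_nbhs_nbhs (conj oV Vfx)).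
exists (f @^-1` closure W)°; split.
- apply: interior_closed_regopen.
  by apply: preimage_closed => [y _|]; [exact: cf|exact: closed_closure].
- by apply: cf; apply: filterS Wfx; exact: subset_closure.
- by move=> y /interior_subset /WV.
Qed.

Section SeminormTopologyInitial.
Context (K : numFieldType) (E : lmodType K) (F : set {scalar E}).

Lemma seminorm_topology_continuous (f : {scalar E}) :
  F f -> continuous (f : seminorm_topology F -> K).
Proof.
move=> Ff x V /nbhs_ballP[e /= e0 eV].
(* One functional with radius [e] suffices: by linearity [f x - f (x + b) = - f b], so the translate
   by [x] lands in the [e]-ball around [f x]. *)
exists [set b | `|f b| < e].
  exists 1%N, (fun=> f), (fun=> e); split=> //.
  by rewrite eqEsubset; split => [b fb i _|b /(_ ord0 I)].
move=> _ [b fb <-]; apply: eV.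
by rewrite /ball /= raddfD opprD addNKr normrN.
Qed.

(** A basic neighbourhood involves only finitely many members of [F], so their conditions hold
    simultaneously near [x]. This half of the universal property gives minimality. *)
Lemma continuous_into_seminorm_topology (X : topologicalType)
    (g : X -> seminorm_topology F) :
  (forall f : {scalar E}, F f -> continuous (f \o g : X -> K)) -> continuous g.
Proof.
move=> cF x U [_ [n [f [r [Ff r0 ->]]]] BU].
have nbhsB : \forall y \near x, forall i : 'I_n, `|f i (g y) - f i (g x)| < r i.
  apply: filter_forall => i.
  have := cF _ (Ff i) x _ (nbhsx_ballx _ _ (r0 i)).
  by rewrite /nbhs /=; apply: filterS => y; rewrite /ball /= distrC.
apply: filterS nbhsB => y fy; apply: BU.
(* Neighbourhoods of [g x] are translates of basic sets at 0, so [g y] is split as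
   [g x + (g y - g x)]. *)
exists (g y - g x); last exact: subrKC.
by move=> i _; rewrite /= raddfB; exact: fy.
Qed.

End SeminormTopologyInitial.

Theorem theorem3p7 (R : realType) (k : scalar_kind)
    (E : topologicalLmodType (scalars R k)) :
  (forall f : {scalar E}, delta_dual E f ->
     delta_continuous (f : delta_weak E -> scalars R k)) /\
  (forall gamma : Topological E,
     let Egamma : topologicalType := Topological.Pack gamma in
     (forall f : {scalar E}, delta_dual E f ->
        delta_continuous (f : Egamma -> scalars R k)) ->
     forall U : set E, @open (delta_weak E) U -> @open Egamma U).
Proof.
split=> [f df|gamma Egamma dF].
  apply: continuous_delta_continuous; first exact: uniform_regular.
  exact: seminorm_topology_continuous.
(* Inclusion of topologies is continuity of the identity; its composite with each dual functional
   [f] is [f] itself on [Egamma]. *)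
have : continuous (id : Egamma -> delta_weak E).
  apply: continuous_into_seminorm_topology => f /dF.
  exact: delta_continuous_continuous.
by move/continuousP.
Qed.
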